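(* Let $w$ be a positive integer, let $F$ be a positive odd integer, and let $a_1,\dots,a_w$ be integers with $0<a_i<F$ for each $i$. For $\operatorname{Re}(s)>w$ define the partial zeta function $$S^{(w)}(s;a_1,\dots,a_w\mid F)=2^w\sum_{\substack{m_1,\dots,m_w>0\\ m_i\equiv a_i \ (\mathrm{mod}\ F)}}\frac{(-1)^{m_1+\cdots+m_w}}{(m_1+\cdots+m_w)^s},$$ and for $x\neq 0,-1,-2,\dots$ the multiple Genocchi zeta function $$\zeta_G^{(w)}(s,x)=2^w\sum_{n_1,\dots,n_w\ge 0}\frac{(-1)^{n_1+\cdots+n_w}}{(x+n_1+\cdots+n_w)^s}.$$ Then $$S^{(w)}(s;a_1,\dots,a_w\mid F)=(-1)^{a_1+\cdots+a_w}F^{-s}\,\zeta_G^{(w)}\!\left(s,\frac{a_1+\cdots+a_w}{F}\right).$$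
   Context: Both series converge absolutely for $\operatorname{Re}(s)>w$; powers $y^{-s}$ with $y>0$ denote the principal branch $e^{-s\log y}$. *)

(* Defs.v *)
From HB Require Import structures.
From mathcomp Require Import all_boot all_order all_algebra.
From mathcomp Require Import finmap.
From mathcomp Require Import complex.
From mathcomp.analysis.showcase Require Export summability.
From mathcomp Require Import all_classical all_reals all_analysis.

Set Implicit Arguments.
Unset Strict Implicit.
Unset Printing Implicit Defensive.

Import Order.TTheory GRing.Theory Num.Theory.
Import numFieldNormedType.Exports.

Local Open Scope classical_set_scope.
Local Open Scope complex_scope.
Local Open Scope ring_scope.

Section ComplexPower.
Variable R : realType.
Implicit Types (z s : R[i]).

Definition cmod z : R := Normc.normc z.

Definition cexp z : R[i] :=
  (expR (complex.Re z))%:C * (cos (complex.Im z) +i* sin (complex.Im z)).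

(* Principal argument of z != 0, with values in ]-pi, pi]. *)
Definition carg z : R :=
  if 0 <= complex.Im z then acos (complex.Re z / cmod z)
  else - acos (complex.Re z / cmod z).

Definition clog z : R[i] := ln (cmod z) +i* carg z.

(* Principal branch of z ^ s; meaningful for z != 0. *)
Definition cpow z s : R[i] := cexp (s * clog z).

End ComplexPower.

Section Series.
Variables (R : realType) (I : choiceType).

(* Unordered sum of f over D: the limit of the sums of f (set to 0 outside D)
   over finite sets of indices, directed by inclusion. *)
Definition csum (D : set I) (f : I -> R[i]) : R[i] :=
  @summability.sum I R[i] R[i]^o (patch (fun=> 0) D f).

Definition abs_cvg (D : set I) (f : I -> R[i]) : Prop :=
  esum.summable D (fun i => (cmod (f i))%:E).

End Series.

Section Zeta.
Variable R : realType.

Definition weight (w : nat) (m : {ffun 'I_w -> nat}) : nat :=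
  (\sum_(i < w) m i)%N.

Definition S_dom (w : nat) (a : 'I_w -> nat) (F : nat) :
    set {ffun 'I_w -> nat} :=
  [set m | forall i, (0 < m i)%N /\ m i = a i %[mod F]].

Definition S_term (w : nat) (s : R[i]) (m : {ffun 'I_w -> nat}) : R[i] :=
  (-1) ^+ weight m * cpow (weight m)%:R (- s).

Definition partial_S (w : nat) (s : R[i]) (a : 'I_w -> nat) (F : nat) : R[i] :=
  2 ^+ w * csum (S_dom a F) (S_term s).

Definition zetaG_term (w : nat) (s x : R[i]) (n : {ffun 'I_w -> nat}) : R[i] :=
  (-1) ^+ weight n * cpow (x + (weight n)%:R) (- s).

(* Meaningful when x is not a nonpositive integer. *)
Definition zetaG (w : nat) (s x : R[i]) : R[i] :=
  2 ^+ w * csum [set: {ffun 'I_w -> nat}] (zetaG_term s x).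

End Zeta.

(* Main.v *)
(** The map [n |-> a + F n] is a bijection from [nat^w] onto the tuples of
    positive integers congruent to [a] modulo [F]; since [F] is odd it sends
    the term of [zetaG] at [x = A / F] to the term of [S] up to the constant
    factor [(-1)^A F^-s], and unordered sums may be reindexed along bijections.
    For absolute convergence, [x + n_1 + ... + n_w] is the sum of the
    [t_i = x / w + n_i], which dominates their geometric mean, so the multiple
    series is bounded by the [w]-th power of
    [\sum_k (x / w + k) `^ (- (Re s / w))], whose exponent [Re s / w] exceeds
    [1]. *)

Require Import Defs.
From mathcomp Require Import all_boot all_order all_algebra.
From mathcomp Require Import complex finmap ring lra.
From mathcomp Require Import all_classical all_reals all_analysis.

Import Order.TTheory GRing.Theory Num.Theory.
Import numFieldNormedType.Exports.

Local Open Scope classical_set_scope.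
Local Open Scope complex_scope.
Local Open Scope ring_scope.

(** * Complex powers of a positive real base *)

Section PositiveBase.
Variable R : realType.
Implicit Types (x y : R) (z s : R[i]).

Lemma cexpD z s : cexp (z + s) = cexp z * cexp s.
Proof.
case: z s => [a b] [c d]; rewrite /cexp /= expRD cosD sinD.
by simpc; congr (_ +i* _); ring.
Qed.

Lemma cmod_cexp z : cmod (cexp z) = expR (complex.Re z).
Proof.
rewrite /cmod Normc.normcM /= expr0n /= addr0 sqrtr_sqr.
by rewrite cos2Dsin2 sqrtr1 mulr1 gtr0_norm ?expR_gt0.
Qed.

Lemma clog_pos x : 0 < x -> clog x%:C = (ln x)%:C.
Proof.
move=> x0; rewrite /clog /carg /cmod /= lexx expr0n /= addr0 sqrtr_sqr.
by rewrite gtr0_norm // divff ?gt_eqF // acos1.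
Qed.

(** On positive reals [clog] is the real logarithm, which is additive, so no multiple of [2 pi i]
    intervenes. *)
Lemma cpow_posM x y s : 0 < x -> 0 < y ->
  cpow (x%:C * y%:C) s = cpow x%:C s * cpow y%:C s.
Proof.
move=> x0 y0; rewrite /cpow -rmorphM /= !clog_pos ?mulr_gt0 //.
by rewrite lnM // rmorphD mulrDr cexpD.
Qed.

Lemma cmod_cpow_pos x s : 0 < x -> cmod (cpow x%:C s) = x `^ complex.Re s.
Proof.
move=> x0; rewrite /cpow clog_pos // cmod_cexp /powR gt_eqF //.
by case: s => u v /=; rewrite mulr0 subr0.
Qed.

Lemma cpow_pos_neq0 x s : 0 < x -> cpow x%:C s != 0.
Proof.
move=> x0; apply/eqP => /(congr1 (@cmod R)); rewrite cmod_cpow_pos //.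
by move/eqP; rewrite /cmod Normc.normc0 gt_eqF ?powR_gt0.
Qed.

Lemma cmod_signM (n : nat) z : cmod ((-1) ^+ n * z) = cmod z.
Proof.
rewrite /cmod -signr_odd; case: odd; last by rewrite mul1r.
by rewrite mulN1r; case: z => u v /=; rewrite !sqrrN.
Qed.

End PositiveBase.

(** * Scaling and reindexing unordered sums *)

Section UnorderedSum.
Variable R : realType.

#[local] Existing Instance totally_filter.

Lemma csumZ (I : choiceType) (D : set I) (f : I -> R[i]) (c : R[i]) :
  c != 0 -> csum D (fun i => c * f i) = c * csum D f.
Proof.
move=> c0; rewrite /csum /summability.sum.
have -> : partial_sum (patch (fun=> 0) D (fun i => c * f i) : I -> R[i]^o) =
          c *: partial_sum (patch (fun=> 0) D f : I -> R[i]^o).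
  apply/funext => A; rewrite /partial_sum [RHS]scaler_sumr.
  apply: eq_bigr => i _.
  by rewrite /patch; case: ifP => // _; rewrite scaler0.
have [fcvg|fdvg] := pselect (cvg
    (partial_sum (patch (fun=> 0) D f : I -> R[i]^o) @ totally)).
  exact: (@limZl_tmp _ _ _ _ _ c _ fcvg).
(* Divergent sums take the junk value [point], which is [0] in [R[i]]. *)
rewrite (dvgP fdvg) dvgP ?is_cvgZlE //.
exact/esym/mulr0.
Qed.

Lemma partial_sumE (I : choiceType) (V : zmodType) (f : I -> V) (A : {fset I}) :
  partial_sum f A = \sum_(i <- A) f i.
Proof. by rewrite /partial_sum big_seq_fsetE. Qed.

(** The partial sum over a finite subset of [J] is the partial sum over its preimage under [e].
    Hence both nets of partial sums generate the same filter, and their limits agree whether or not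
    they converge. *)
Lemma reindex_csum (I J : choiceType) (e : I -> J) (g : J -> I)
    (f : J -> R[i]) :
  cancel e g -> csum (range e) f = csum [set: I] (f \o e).
Proof.
move=> eK; rewrite /csum /summability.sum.
set p := partial_sum _; set q := partial_sum _.
have qE (B : {fset I}) : q B = \sum_(i <- B) f (e i).
  by rewrite /q partial_sumE; apply: eq_bigr => i _; rewrite /patch in_setT.
have pE (B : {fset J}) : p B = q (g @` [fset j in B | j \in range e])%fset.
  rewrite qE big_imfset /=; last first.
    move=> j k; rewrite !inE /= => /andP[_ /[!inE] -[i _ <-]].
    by move=> /andP[_ /[!inE] -[i' _ <-]]; rewrite !eK => ->.
  rewrite /p partial_sumE /patch -big_mkcond big_fset_condE /=.
  rewrite big_seq [RHS]big_seq.
  apply: eq_bigr => j; rewrite !inE /= => /andP[_ /[!inE] -[i _ <-]].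
  by rewrite eK.
(* Cofinality: every finite [B] containing the preimage of [A] is itself the preimage of a finite
   set containing [A], namely the union of [A] with the image of [B]. *)
have imK (B : {fset I}) (A : {fset J}) :
    (g @` [fset j in A | j \in range e] `<=` B)%fset ->
    (g @` [fset j in (e @` B) `|` A | j \in range e])%fset = B.
  move=> AB; apply/fsetP => i; apply/imfsetP/idP => /= [[j]|iB].
    rewrite !inE /= => /andP[/orP[/imfsetP[k /= kB ->] _ ->|jA jr ->]].
      by rewrite eK.
    by apply: (fsubsetP AB); apply/imfsetP; exists j; rewrite //= !inE jA.
  exists (e i); rewrite ?eK // !inE /= in_imfset //=.
  by apply/mem_set; exists i.
suff -> : p @ totally = q @ totally by [].
apply/seteqP; split=> U [A _ AU].
  exists (g @` [fset j in A | j \in range e])%fset => // B /= /imK <-.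
  by rewrite -pE; apply: AU; rewrite /= fsubsetUr.
exists (e @` A)%fset => // B /= AB; rewrite pE; apply: AU => /=.
apply/fsubsetP => i iA; apply/imfsetP; exists (e i) => //=.
rewrite !inE (fsubsetP AB) /=; last by rewrite in_imfset.
by apply/mem_set; exists i.
Qed.

End UnorderedSum.

(** * Convergence of the multiple series of real powers *)

Section PowerSums.
Variable R : realType.
Implicit Types (x y p q : R).

Lemma ln_ge1BV x : 0 < x -> 1 - x^-1 <= ln x.
Proof.
move=> x0; rewrite -[x in ln x]invrK lnV ?posrE ?invr_gt0 //.
have := @expR_ge1Dx R (ln x^-1).
rewrite lnK ?posrE ?invr_gt0 // => h; lra.
Qed.

Lemma powR_succ_le_telescope x q : 0 < x -> 0 < q ->
  q * (x + 1) `^ (- (q + 1)) <= x `^ (- q) - (x + 1) `^ (- q).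
Proof.
move=> x0 q0; have x10 : 0 < x + 1 by rewrite addr_gt0.
have -> : x `^ (- q) = (x + 1) `^ (- q) * expR (q * ln ((x + 1) / x)).
  rewrite /powR !gt_eqF // -expRD; congr expR.
  by rewrite lnM ?posrE ?invr_gt0 // lnV ?posrE //; ring.
have -> : (x + 1) `^ (- (q + 1)) = (x + 1) `^ (- q) / (x + 1).
  rewrite opprD powRD; last by rewrite (gt_eqF x10) implybT.
  by rewrite powR_inv1 // ltW.
rewrite mulrCA -[X in _ <= _ - X]mulr1 -mulrBr ler_pM2l ?powR_gt0 //.
rewrite lerBrDl; apply: le_trans (expR_ge1Dx _); rewrite lerD2l ler_pM2l //.
have := @ln_ge1BV ((x + 1) / x); rewrite divr_gt0 // => /(_ isT).
have -> : 1 - ((x + 1) / x)^-1 = (x + 1)^-1; last by [].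
by rewrite invf_div; field; rewrite gt_eqF.
Qed.

(** The term [k = 0] is set apart; the others telescope by the previous bound with [q = p - 1]. The
    bound is uniform in [n]. *)
Lemma sum_powR_le y p n : 0 < y -> 1 < p ->
  \sum_(k < n) (y + k%:R) `^ (- p) <= y `^ (- p) + y `^ (1 - p) / (p - 1).
Proof.
move=> y0 p1; have q0 : 0 < p - 1 by rewrite subr_gt0.
case: n => [|n]; first by rewrite big_ord0 addr_ge0 ?divr_ge0 ?powR_ge0 // ltW.
rewrite big_ord_recl addr0 lerD2l ler_pdivlMr // mulr_suml.
have -> : y `^ (1 - p) = (y + 0%:R) `^ (- (p - 1)) by rewrite addr0 opprB.
apply: (@le_trans _ _ ((y + 0%:R) `^ (- (p - 1)) - (y + n%:R) `^ (- (p - 1))));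
  last by rewrite gerBl powR_ge0.
rewrite -[leRHS]opprB -(telescope_sumr (fun k => (y + k%:R) `^ (- (p - 1)))) //.
rewrite -sumrN big_mkord; apply: ler_sum => k _; rewrite opprB mulrC.
have yk0 : 0 < y + k%:R by rewrite ltr_wpDr.
have := powR_succ_le_telescope _ _ yk0 q0.
by rewrite subrK -addrA natr1 lift0.
Qed.

(** Each [t i] is at most the whole sum, so the sum to the power [- p] is at most each factor;
    multiply these [w] inequalities. *)
Lemma powR_sumN_le_prod (w : nat) (t : 'I_w -> R) p : (0 < w)%N -> 0 <= p ->
  (forall i, 0 < t i) ->
  (\sum_i t i) `^ (- (w%:R * p)) <= \prod_i t i `^ (- p).
Proof.
move=> w0 p0 t0; have i0 : 'I_w := Ordinal w0.
have St i : t i <= \sum_j t j.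
  by rewrite (bigD1 i) //= lerDl sumr_ge0 // => j _; rewrite ltW.
have S0 : 0 < \sum_i t i := lt_le_trans (t0 i0) (St i0).
rewrite mulrC -mulNr powRrM powR_mulrn ?powR_ge0 //.
rewrite -[w in _ ^+ w]card_ord -prodr_const.
apply: ler_prod => i _; rewrite powR_ge0 /= !powRN lef_pV2 ?posrE ?powR_gt0 //.
by apply: ge0_ler_powR; rewrite ?nnegrE // ltW.
Qed.

Lemma esum_weight_powR_lty (w : nat) x p : (0 < w)%N -> 0 < x -> w%:R < p ->
  (\esum_(n in [set: {ffun 'I_w -> nat}])
     ((x + (weight n)%:R) `^ (- p))%:E < +oo)%E.
Proof.
move=> w0 x0 wp; have wR : 0 < w%:R :> R by rewrite ltr0n.
pose y := x / w%:R; pose q := p / w%:R.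
have y0 : 0 < y by rewrite divr_gt0.
have q1 : 1 < q by rewrite ltr_pdivlMr // mul1r.
pose h (k : nat) := (y + k%:R) `^ (- q).
have h0 k : 0 <= h k by exact: powR_ge0.
pose C := y `^ (- q) + y `^ (1 - q) / (q - 1).
have termE (n : {ffun 'I_w -> nat}) :
    (x + (weight n)%:R) `^ (- p) <= \prod_i h (n i).
  have -> : x + (weight n)%:R = \sum_(i < w) (y + (n i)%:R).
    rewrite big_split /= sumr_const card_ord -[y *+ w]mulr_natr.
    rewrite divfK ?gt_eqF //.
    by rewrite /weight natr_sum.
  have -> : p = w%:R * q by rewrite mulrC divfK // gt_eqF.
  apply: powR_sumN_le_prod => // [|i]; first by rewrite ltW // (lt_trans _ q1).
  by rewrite ltr_wpDr.
apply: (@le_lt_trans _ _ (C ^+ w)%:E); last exact: ltry.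
apply: ge_ereal_sup => _ [X [finX _] <-].
(* The finite set [X] lies in the box of tuples with entries at most [N]; over that box the sum of
   products factors into a [w]-th power of a one-variable sum, at most [C ^+ w]. *)
pose N := (\max_(n <- fset_set X) \max_i n i)%N.
have XN (n : {ffun 'I_w -> nat}) i : X n -> (n i <= N)%N.
  move=> Xn; rewrite /N; apply: leq_trans (leq_bigmax i) _.
  have nX : n \in fset_set X by rewrite in_fset_set ?inE.
  by rewrite (big_fsetD1 _ nX) /= leq_maxl.
pose r (n : {ffun 'I_w -> nat}) : {ffun 'I_w -> 'I_N.+1} :=
  [ffun i => inord (n i)].
have rE n i : X n -> r n i = n i :> nat.
  by move=> Xn; rewrite ffunE inordK // ltnS XN.
apply: (@le_trans _ _ (\sum_(f : {ffun 'I_w -> 'I_N.+1}) \prod_i h (f i))%:E);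
  last first.
  rewrite lee_fin -(bigA_distr_bigA (fun (_ : 'I_w) (k : 'I_N.+1) => h k)) /=.
  rewrite -[w in leRHS]card_ord -prodr_const.
  apply: ler_prod => i _; rewrite sum_powR_le // andbT.
  by apply: sumr_ge0 => k _; exact: h0.
rewrite fsbig_finite //= sumEFin lee_fin.
have memX n : n \in fset_set X -> X n by rewrite in_fset_set // inE.
apply: (@le_trans _ _ (\sum_(n <- fset_set X) \prod_i h (r n i))).
  rewrite big_seq [leRHS]big_seq; apply: ler_sum => n /memX Xn.
  by under eq_bigr do rewrite (rE _ _ Xn).
have <- : \sum_(f <- (r @` fset_set X)%fset) \prod_i h (f i) =
          \sum_(n <- fset_set X) \prod_i h (r n i).
  rewrite big_imfset //= => m n /memX Xm /memX Xn mn; apply/ffunP => i.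
  by rewrite -(rE m) // -(rE n) // mn.
rewrite big_uniq ?fset_uniq // big_mkcond; apply: ler_sum => f _ /=.
by case: ifP => // _; rewrite prodr_ge0.
Qed.

End PowerSums.

(** * Parametrisation of the residue classes *)

Section ResidueClass.
Variables (w F : nat) (a : 'I_w -> nat).

Definition lift_residue (n : {ffun 'I_w -> nat}) : {ffun 'I_w -> nat} :=
  [ffun i => a i + F * n i]%N.

Lemma weight_lift_residue n :
  weight (lift_residue n) = (\sum_(i < w) a i + F * weight n)%N.
Proof.
rewrite /weight big_distrr /= -big_split /=.
by apply: eq_bigr => i _; rewrite ffunE.
Qed.

Hypothesis a_bnd : forall i, (0 < a i < F)%N.

Lemma lift_residueK : cancel lift_residue (fun m => [ffun i => m i %/ F]%N).
Proof.
move=> n; apply/ffunP => i; have /andP[_ aF] := a_bnd i.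
have F_gt0 : (0 < F)%N by exact: leq_ltn_trans aF.
by rewrite !ffunE addnC mulnC divnMDl // divn_small ?addn0.
Qed.

(** Since [a i < F], the remainder of [m i] is exactly [a i], so the quotients give the preimage;
    [0 < a i] makes every lifted entry positive. *)
Lemma range_lift_residue : range lift_residue = S_dom a F.
Proof.
apply/seteqP; split=> [_ [n _ <-] i|m mD].
  have /andP[a0 _] := a_bnd i.
  by rewrite ffunE addn_gt0 a0 addnC mulnC modnMDl.
exists [ffun i => m i %/ F]%N => //; apply/ffunP => i; rewrite !ffunE.
have /andP[_ aF] := a_bnd i; have [_ mi] := mD i.
by rewrite [RHS](divn_eq _ F) mi (modn_small aF) addnC mulnC.
Qed.

End ResidueClass.

Arguments lift_residue {w} F a n.

(** * Comparison of the terms of the two series *)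

Section Rescaling.
Variables (R : realType) (w : nat) (s : R[i]).
Implicit Types n : {ffun 'I_w -> nat}.

Lemma cmod_zetaG_term (x : R) n : 0 < x ->
  cmod (zetaG_term s x%:C n) = (x + (weight n)%:R) `^ (- complex.Re s).
Proof.
move=> x0; rewrite cmod_signM -[(weight n)%:R](rmorph_nat (real_complex R)).
rewrite -rmorphD cmod_cpow_pos ?ltr_wpDr //.
by case: s.
Qed.

Lemma S_term_lift_residue (F : nat) (a : 'I_w -> nat) n : odd F ->
  (0 < \sum_(i < w) a i)%N ->
  S_term s (lift_residue F a n) =
  (-1) ^+ (\sum_(i < w) a i) * cpow F%:R (- s) *
  zetaG_term s ((\sum_(i < w) a i)%:R / F%:R) n.
Proof.
move=> F_odd A_gt0; have F_gt0 := odd_gt0 F_odd.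
rewrite /S_term /zetaG_term weight_lift_residue.
set A := (\sum_(i < w) a i)%N in A_gt0 *; set N := weight n.
have FC : F%:R = (F%:R : R)%:C by rewrite -[LHS](rmorph_nat (real_complex R)).
have AC : A%:R / F%:R + N%:R = (A%:R / F%:R + N%:R : R)%:C.
  by rewrite rmorphD rmorph_nat fmorph_div !rmorph_nat.
have -> : (A + F * N)%:R = F%:R * (A%:R / F%:R + N%:R) :> R[i].
  by rewrite natrD natrM mulrDr mulrCA divff ?mulr1 // pnatr_eq0 -lt0n.
rewrite AC FC cpow_posM ?ltr0n //; last first.
  by rewrite ltr_wpDr // divr_gt0 ?ltr0n.
(* Oddness of [F] enters here: [(-1) ^+ (F * N)] becomes [(-1) ^+ N]. *)
rewrite exprD exprM -[(-1) ^+ F]signr_odd F_odd expr1.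
by rewrite [RHS]mulrACA.
Qed.

End Rescaling.

Theorem theorem2 (R : realType) (w : nat) (F : nat) (a : 'I_w -> nat) (s : R[i])
    (w_gt0 : (0 < w)%N) (F_gt0 : (0 < F)%N) (F_odd : odd F)
    (a_bnd : forall i : 'I_w, (0 < a i < F)%N)
    (s_gtw : w%:R < complex.Re s) :
  let A := (\sum_(i < w) a i)%N in
  let x : R[i] := A%:R / F%:R in
  [/\ abs_cvg (S_dom a F) (S_term s),
      abs_cvg [set: {ffun 'I_w -> nat}] (zetaG_term s x) &
      partial_S s a F = (-1) ^+ A * cpow F%:R (- s) * zetaG w s x].
Proof.
move=> A x.
have A_gt0 : (0 < A)%N.
  rewrite /A (bigD1 (Ordinal w_gt0)) //= addn_gt0.
  by have /andP[->] := a_bnd (Ordinal w_gt0).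
have xC : x = (A%:R / F%:R : R)%:C by rewrite fmorph_div !rmorph_nat.
have x0 : 0 < A%:R / F%:R :> R by rewrite divr_gt0 ?ltr0n.
have FC : F%:R = (F%:R : R)%:C by rewrite rmorph_nat.
have termE n : S_term s (lift_residue F a n) =
    (-1) ^+ A * cpow F%:R (- s) * zetaG_term s x n.
  exact: S_term_lift_residue.
split.
- rewrite /abs_cvg /esum.summable -(range_lift_residue _ _ _ a_bnd).
  rewrite esum_image; last first.
    by move=> m n _ _; exact: (can_inj (lift_residueK _ _ _ a_bnd)).
  (* Since [F >= 1], the base [A + F * weight n] is at least [A + weight n], which gives a
     convergent majorant with [x = A]. *)
  apply: le_lt_trans (esum_weight_powR_lty _ _ A%:R _ w_gt0 _ s_gtw);
    last by rewrite ltr0n.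
  apply: le_esum => n _; rewrite lee_fin cmod_signM weight_lift_residue.
  rewrite -[X in cpow X](rmorph_nat (real_complex R)) cmod_cpow_pos; last first.
    by rewrite ltr0n addn_gt0 A_gt0.
  rewrite ger0_norm ?powR_ge0 //.
  have -> : complex.Re (- s) = - complex.Re s by case: (s).
  have s0 : 0 < complex.Re s by apply: lt_trans s_gtw; rewrite ltr0n.
  rewrite !powRN -natrD lef_pV2 ?posrE ?powR_gt0 ?ltr0n ?addn_gt0 ?A_gt0 //.
  apply: ge0_ler_powR; rewrite ?nnegrE ?ler0n ?(ltW s0) // ler_nat leq_add2l.
  exact: leq_pmull.
- apply: le_lt_trans (esum_weight_powR_lty _ _ _ _ w_gt0 x0 s_gtw).
  apply: le_esum => n _; rewrite xC cmod_zetaG_term // lee_fin.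
  by rewrite ger0_norm ?powR_ge0.
rewrite /partial_S /zetaG -(range_lift_residue _ _ _ a_bnd).
(* Both sides become sums over all tuples; the nonzero constant moves inside the right one, and the
   terms then agree by [termE]. *)
rewrite (reindex_csum _ _ _ _ _ _ (lift_residueK _ _ _ a_bnd)) [RHS]mulrCA.
rewrite -[(-1) ^+ A * _ * csum _ _]csumZ; last first.
  by rewrite mulf_neq0 ?signr_eq0 // FC cpow_pos_neq0 ?ltr0n.
by congr (_ * csum _ _); apply/funext.
Qed.
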